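(* Let $\mathcal{C}$ be a category with weak equivalences and $\mathcal{I},\mathcal{J}$ two index categories. Suppose the adjunctions $\operatorname{colim}_{\mathcal{I}}\dashv\Delta$ between $(\mathcal{C}^{\mathcal{J}})^{\mathcal{I}}$ and $\mathcal{C}^{\mathcal{J}}$ and between $\mathcal{C}^{\mathcal{I}}$ and $\mathcal{C}$ exist and are derivable, with derived adjunctions $\operatorname{hocolim}_{\mathcal{I}}\dashv\operatorname{Ho}\Delta$. Suppose further that for every $J\in\mathcal{J}$ the two evaluation functors $\operatorname{ev}_J\colon\mathcal{C}^{\mathcal{J}}\to\mathcal{C}$ and $\operatorname{ev}_J\colon(\mathcal{C}^{\mathcal{I}})^{\mathcal{J}}\to\mathcal{C}^{\mathcal{I}}$ have fully faithful left adjoints $J_!$, that both adjunctions $J_!\dashv\operatorname{ev}_J$ are derivable, and that there is an isomorphism of functors $\operatorname{hocolim}_{\mathcal{I}}\circ\operatorname{Ho}\operatorname{ev}_J\cong\operatorname{Ho}\operatorname{ev}_J\circ\operatorname{hocolim}_{\mathcal{I}}$ from $\operatorname{Ho}((\mathcal{C}^{\mathcal{I}})^{\mathcal{J}})\cong\operatorname{Ho}((\mathcal{C}^{\mathcal{J}})^{\mathcal{I}})$ to $\operatorname{Ho}\mathcal{C}$. Then there is a family of isomorphisms $$\beta_J\colon\operatorname{hocolim}_{\mathcal{I}}\circ\operatorname{Ho}\operatorname{ev}_J\ \cong\ \operatorname{Ho}\operatorname{ev}_J\circ\operatorname{hocolim}_{\mathcal{I}}\qquad(J\in\mathcal{J})$$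 natural in $J$, i.e. $(\operatorname{Ho}\operatorname{ev}_j)_{\operatorname{hocolim}_{\mathcal{I}}}\circ\beta_J=\beta_{J'}\circ\operatorname{hocolim}_{\mathcal{I}}(\operatorname{Ho}\operatorname{ev}_j)$ for every $j\colon J\to J'$ in $\mathcal{J}$.
   Context: A category with weak equivalences is a category $\mathcal{C}$ with a class of morphisms (the weak equivalences), assumed to contain all isomorphisms. Its localisation $H_{\mathcal{C}}\colon\mathcal{C}\to\operatorname{Ho}\mathcal{C}$ sends weak equivalences to isomorphisms, and every functor out of $\mathcal{C}$ that does so factors uniquely (strictly) through $H_{\mathcal{C}}$. A functor $F\colon\mathcal{C}\to\mathcal{D}$ is homotopical if it preserves weak equivalences; then $\operatorname{Ho}F$ is the unique functor with $\operatorname{Ho}F\circ H_{\mathcal{C}}=H_{\mathcal{D}}\circ F$. $\operatorname{Ho}$ is strictly 2-functorial on homotopical functors. Write $K\tau$, $\tau_K$ for post- and pre-whiskering. An absolute total left derived functor of $F\colon\mathcal{C}\to\mathcal{D}$ is a pair $(\mathbb{L}F,\ \lambda\colon\mathbb{L}F\circ H_{\mathcal{C}}\Rightarrow H_{\mathcal{D}}\circ F)$ that is an absolute right Kan extension of $H_{\mathcal{D}}\circ F$ along $H_{\mathcal{C}}$ (a right Kan extension preserved by every functor out of $\operatorname{Ho}\mathcal{D}$). Dually, an absolute total right derived functor $(\mathbb{R}G,\ \rho\colon H_{\mathcal{C}}\circ G\Rightarrow\mathbb{R}G\circ H_{\mathcal{D}})$ of $G\colon\mathcal{D}\to\mathcal{C}$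 is an absolute left Kan extension of $H_{\mathcal{C}}\circ G$ along $H_{\mathcal{D}}$. If $F$ is homotopical, $\operatorname{Ho}F$ with the identity is both. A derived adjunction of $(F\dashv G,\eta,\varepsilon)$ is an adjunction $(\mathbb{L}F\dashv\mathbb{R}G,\dot\eta,\dot\varepsilon)$ with absolute total derived functors $(\mathbb{L}F,\lambda)$, $(\mathbb{R}G,\rho)$ of $F$ and $G$ such that $\mathbb{R}G\lambda\circ\dot\eta_{H_{\mathcal{C}}}=\rho_F\circ H_{\mathcal{C}}\eta$ and $\dot\varepsilon_{H_{\mathcal{D}}}\circ\mathbb{L}F\rho=H_{\mathcal{D}}\varepsilon\circ\lambda_G$; if one exists, $F\dashv G$ is derivable. Diagram categories $\mathcal{C}^{\mathcal{I}}$ carry pointwise weak equivalences; $\Delta$ is the constant diagram functor and $\operatorname{ev}_J$ evaluation at $J$ (both homotopical, so $\mathbb{R}\Delta=\operatorname{Ho}\Delta$ and $\mathbb{R}\operatorname{ev}_J=\operatorname{Ho}\operatorname{ev}_J$); $\operatorname{hocolim}_{\mathcal{I}}:=\mathbb{L}\operatorname{colim}_{\mathcal{I}}$. For $j\colon J\to J'$, $\operatorname{Ho}\operatorname{ev}_j\colon\operatorname{Ho}\operatorname{ev}_J\Rightarrow\operatorname{Ho}\operatorname{ev}_{J'}$ is the transformation induced by evaluating diagrams at $j$. *)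

(* Defs.v *)
From Stdlib Require Import FunctionalExtensionality PropExtensionality.
From Stdlib Require Import ProofIrrelevance IndefiniteDescription.

Set Implicit Arguments.
Unset Strict Implicit.
Unset Printing Implicit Defensive.

Declare Scope hom_scope.
Declare Scope functor_scope.
Delimit Scope hom_scope with hom.
Delimit Scope functor_scope with functor.
Open Scope hom_scope.

Record category : Type := Category {
  ob :> Type;
  hom : ob -> ob -> Type;
  idc : forall x, hom x x;
  comp : forall x y z, hom y z -> hom x y -> hom x z;
  comp_assoc : forall x y z t (h : hom z t) (g : hom y z) (f : hom x y),
    comp h (comp g f) = comp (comp h g) f;
  comp_idl : forall x y (f : hom x y), comp (idc y) f = f;
  comp_idr : forall x y (f : hom x y), comp f (idc x) = f
}.
Arguments hom {c} x y.
Arguments idc {c} x.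
Arguments comp {c x y z} g f.
Bind Scope hom_scope with hom.
Notation "g ∘ f" := (comp g f) (at level 40, left associativity) : hom_scope.

Definition is_inverse (C : category) (x y : C) (f : hom x y) (g : hom y x) : Prop :=
  g ∘ f = idc x /\ f ∘ g = idc y.

Definition is_iso (C : category) (x y : C) (f : hom x y) : Prop :=
  exists g : hom y x, is_inverse f g.

Record functor (C D : category) : Type := Functor {
  fobj :> C -> D;
  fmap : forall x y, hom x y -> hom (fobj x) (fobj y);
  fmap_id : forall x, fmap (idc x) = idc (fobj x);
  fmap_comp : forall x y z (g : hom y z) (f : hom x y),
    fmap (g ∘ f) = fmap g ∘ fmap f
}.
Arguments fmap {C D} F {x y} f : rename.

Lemma functor_eq (C D : category) (o : C -> D)
    (m m' : forall x y, hom x y -> hom (o x) (o y)) h1 h2 h1' h2' :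
  m = m' -> @Functor C D o m h1 h2 = @Functor C D o m' h1' h2'.
Proof. intros <-; f_equal; apply proof_irrelevance. Qed.

Bind Scope functor_scope with functor.

Definition fid (C : category) : functor C C :=
  Functor (fobj := fun x : C => x) (fmap := fun x y f => f)
    (fun x => eq_refl) (fun x y z g f => eq_refl).

Section FComp.
Variables (C D E : category) (G : functor D E) (F : functor C D).

Lemma fcomp_id (x : C) : fmap G (fmap F (idc x)) = idc (G (F x)).
Proof. now rewrite !fmap_id. Qed.

Lemma fcomp_comp (x y z : C) (g : hom y z) (f : hom x y) :
  fmap G (fmap F (g ∘ f)) = fmap G (fmap F g) ∘ fmap G (fmap F f).
Proof. now rewrite !fmap_comp. Qed.

Definition fcomp : functor C E := Functor fcomp_id fcomp_comp.
End FComp.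
Notation "G ∘ F" := (fcomp G F) : functor_scope.

Definition fully_faithful (C D : category) (F : functor C D) : Prop :=
  forall (x y : C) (g : hom (F x) (F y)), exists! f : hom x y, fmap F f = g.

Record nattrans (C D : category) (F G : functor C D) : Type := NatTrans {
  ntc :> forall x : C, hom (F x) (G x);
  nt_nat : forall (x y : C) (f : hom x y), ntc y ∘ fmap F f = fmap G f ∘ ntc x
}.
Arguments nattrans {C D} (F G)%_functor.

Lemma nattrans_eq (C D : category) (F G : functor C D) (s t : nattrans F G) :
  (forall x, s x = t x) -> s = t.
Proof.
destruct s as [s hs], t as [t ht]; simpl; intro e.
assert (s = t) as -> by (apply functional_extensionality_dep; exact e).
f_equal; apply proof_irrelevance.
Qed.

Section FunCat.
Variables (I C : category).

Definition nt_id (F : functor I C) : nattrans F F.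
Proof.
exists (fun i => idc (F i)).
intros i j f; now rewrite comp_idl, comp_idr.
Defined.

Definition nt_comp (F G H : functor I C) (t : nattrans G H) (s : nattrans F G) :
  nattrans F H.
Proof.
exists (fun i => t i ∘ s i).
intros i j f.
now rewrite <- comp_assoc, nt_nat, comp_assoc, nt_nat, <- comp_assoc.
Defined.

Definition fun_cat : category.
Proof.
refine (@Category (functor I C) (@nattrans I C) nt_id nt_comp _ _ _).
- intros; apply nattrans_eq; intro i; apply comp_assoc.
- intros; apply nattrans_eq; intro i; apply comp_idl.
- intros; apply nattrans_eq; intro i; apply comp_idr.
Defined.
End FunCat.

Definition nat_iso (C D : category) (F G : functor C D) (t : nattrans F G) : Prop :=
  is_iso (C := fun_cat C D) t.

Definition isomorphic (C D : category) (F G : functor C D) : Prop :=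
  exists t : nattrans F G, nat_iso t.
Arguments isomorphic {C D} (F G)%_functor.

Record adjunction (C D : category) (F : functor C D) (G : functor D C) : Type :=
  Adjunction {
  unit : nattrans (fid C) (G ∘ F);
  counit : nattrans (F ∘ G) (fid D);
  triangle_l : forall x : C, counit (F x) ∘ fmap F (unit x) = idc (F x);
  triangle_r : forall y : D, fmap G (counit y) ∘ unit (G y) = idc (G y)
}.

Section Kan.
Variables (A B X : category) (P : functor A B) (K : functor A X) (L : functor B X).

Definition is_right_kan (l : nattrans (L ∘ P) K) : Prop :=
  forall (M : functor B X) (m : nattrans (M ∘ P) K),
  exists! d : nattrans M L, forall a : A, l a ∘ d (P a) = m a.

Definition is_left_kan (r : nattrans K (L ∘ P)) : Prop :=
  forall (M : functor B X) (m : nattrans K (M ∘ P)),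
  exists! d : nattrans L M, forall a : A, d (P a) ∘ r a = m a.

End Kan.

Section AbsoluteKan.
Variables (A B X : category) (P : functor A B) (K : functor A X) (L : functor B X).

(* Whiskering with E, where E ∘ (L ∘ P) is reassociated to (E ∘ L) ∘ P. *)
Definition whisker_r (l : nattrans (L ∘ P) K) (Y : category) (E : functor X Y) :
  nattrans ((E ∘ L) ∘ P) (E ∘ K).
Proof.
exists (fun a => fmap E (l a)).
intros a b f; simpl; rewrite <- !fmap_comp; f_equal; exact (nt_nat l f).
Defined.

Definition whisker_l (r : nattrans K (L ∘ P)) (Y : category) (E : functor X Y) :
  nattrans (E ∘ K) ((E ∘ L) ∘ P).
Proof.
exists (fun a => fmap E (r a)).
intros a b f; simpl; rewrite <- !fmap_comp; f_equal; exact (nt_nat r f).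
Defined.

Definition is_abs_right_kan (l : nattrans (L ∘ P) K) : Prop :=
  is_right_kan l /\
  forall (Y : category) (E : functor X Y), is_right_kan (whisker_r l E).

Definition is_abs_left_kan (r : nattrans K (L ∘ P)) : Prop :=
  is_left_kan r /\
  forall (Y : category) (E : functor X Y), is_left_kan (whisker_l r E).

End AbsoluteKan.

Record wecat : Type := WeCat {
  wcat :> category;
  weq : forall x y : wcat, hom x y -> Prop;
  weq_iso : forall (x y : wcat) (f : hom x y), is_iso f -> weq f
}.
Arguments weq {w x y} f.

Definition inverts (C : wecat) (D : category) (F : functor C D) : Prop :=
  forall (x y : C) (f : hom x y), weq f -> is_iso (fmap F f).

Section Quotient.
Variables (T : Type) (R : T -> T -> Prop).
Hypothesis Rrefl : forall x, R x x.
Hypothesis Rsym : forall x y, R x y -> R y x.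
Hypothesis Rtrans : forall x y z, R x y -> R y z -> R x z.

Definition quot : Type := {P : T -> Prop | exists t, P = R t}.

Definition cls (t : T) : quot :=
  exist (fun P => exists t, P = R t) (R t) (ex_intro _ t eq_refl).

Definition repr (q : quot) : T :=
  proj1_sig (constructive_indefinite_description _ (proj2_sig q)).

Lemma cls_repr (q : quot) : cls (repr q) = q.
Proof.
unfold repr.
destruct (constructive_indefinite_description _ _) as [t e]; simpl.
destruct q as [P h]; simpl in *; subst P.
unfold cls; f_equal; apply proof_irrelevance.
Qed.

Lemma cls_eq (s t : T) : R s t -> cls s = cls t.
Proof.
intro h.
assert (e : R s = R t).
{ apply functional_extensionality; intro u; apply propositional_extensionality.
  split; intro h'; [exact (Rtrans (Rsym h) h') | exact (Rtrans h h')]. }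
unfold cls; generalize (ex_intro (fun t0 => R s = R t0) s eq_refl).
rewrite e; intro h'; f_equal; apply proof_irrelevance.
Qed.

Lemma cls_inj (s t : T) : cls s = cls t -> R s t.
Proof.
intro e; apply (f_equal (@proj1_sig _ _)) in e; simpl in e.
rewrite e; apply Rrefl.
Qed.

Lemma repr_cls (t : T) : R (repr (cls t)) t.
Proof. apply cls_inj, cls_repr. Qed.
End Quotient.

(* Ho C has the objects of C; its morphisms are formal composites of morphisms
   of C and of formal inverses of weak equivalences, modulo the congruence
   generated by the category laws, functoriality of C -> Ho C and the
   invertibility of weak equivalences. *)
Section Localisation.
Variable C : wecat.

Inductive word : C -> C -> Type :=
| w_mor (x y : C) (f : hom x y) : word x y
| w_inv (x y : C) (f : hom x y) (hf : weq f) : word y x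
| w_comp (x y z : C) (v : word y z) (u : word x y) : word x z.

Inductive wrel : forall x y : C, word x y -> word x y -> Prop :=
| wr_refl x y (u : word x y) : wrel u u
| wr_sym x y (u v : word x y) : wrel u v -> wrel v u
| wr_trans x y (u v w : word x y) : wrel u v -> wrel v w -> wrel u w
| wr_cong x y z (v v' : word y z) (u u' : word x y) :
    wrel v v' -> wrel u u' -> wrel (w_comp v u) (w_comp v' u')
| wr_assoc x y z t (w : word z t) (v : word y z) (u : word x y) :
    wrel (w_comp w (w_comp v u)) (w_comp (w_comp w v) u)
| wr_idl x y (u : word x y) : wrel (w_comp (w_mor (idc y)) u) u
| wr_idr x y (u : word x y) : wrel (w_comp u (w_mor (idc x))) u
| wr_mor x y z (g : hom y z) (f : hom x y) :
    wrel (w_mor (g ∘ f)) (w_comp (w_mor g) (w_mor f))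
| wr_invl x y (f : hom x y) (hf : weq f) :
    wrel (w_comp (w_inv hf) (w_mor f)) (w_mor (idc x))
| wr_invr x y (f : hom x y) (hf : weq f) :
    wrel (w_comp (w_mor f) (w_inv hf)) (w_mor (idc y)).

Definition ho_hom (x y : C) : Type := quot (@wrel x y).

Definition ho_cls (x y : C) (u : word x y) : ho_hom x y := cls (@wrel x y) u.

Lemma ho_cls_eq (x y : C) (u v : word x y) : wrel u v -> ho_cls u = ho_cls v.
Proof.
intro h; apply cls_eq; [apply wr_sym | apply wr_trans | exact h].
Qed.

Lemma ho_repr_cls (x y : C) (u : word x y) : wrel (repr (ho_cls u)) u.
Proof. apply repr_cls; apply wr_refl. Qed.

Definition ho_comp (x y z : C) (g : ho_hom y z) (f : ho_hom x y) : ho_hom x z :=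
  ho_cls (w_comp (repr g) (repr f)).

Lemma ho_comp_cls (x y z : C) (v : word y z) (u : word x y) :
  ho_comp (ho_cls v) (ho_cls u) = ho_cls (w_comp v u).
Proof. apply ho_cls_eq, wr_cong; apply ho_repr_cls. Qed.

Lemma ho_clsP (x y : C) (f : ho_hom x y) : exists u, f = ho_cls u.
Proof. exists (repr f); symmetry; apply cls_repr. Qed.

Definition Ho : category.
Proof.
refine (@Category C ho_hom (fun x => ho_cls (w_mor (idc x))) ho_comp _ _ _).
- intros x y z t h g f.
  destruct (ho_clsP h) as [w ->], (ho_clsP g) as [v ->], (ho_clsP f) as [u ->].
  rewrite !ho_comp_cls; apply ho_cls_eq, wr_assoc.
- intros x y f; destruct (ho_clsP f) as [u ->].
  rewrite ho_comp_cls; apply ho_cls_eq, wr_idl.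
- intros x y f; destruct (ho_clsP f) as [u ->].
  rewrite ho_comp_cls; apply ho_cls_eq, wr_idr.
Defined.

Definition loc : functor C Ho.
Proof.
refine (@Functor C Ho (fun x => x) (fun x y f => ho_cls (w_mor f)) _ _).
- reflexivity.
- intros x y z g f; simpl; rewrite ho_comp_cls; apply ho_cls_eq, wr_mor.
Defined.

Lemma loc_inverts : inverts loc.
Proof.
intros x y f hf; exists (ho_cls (w_inv hf)); split; simpl;
  rewrite ho_comp_cls; apply ho_cls_eq; [apply wr_invl | apply wr_invr].
Qed.

Section Lift.
Variables (D : category) (F : functor C D) (hF : inverts F).

Fixpoint ho_eval (x y : C) (u : word x y) : hom (F x) (F y) :=
  match u in word x y return hom (F x) (F y) with
  | w_mor f => fmap F f
  | w_inv hf => proj1_sig (constructive_indefinite_description _ (hF hf))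
  | w_comp v u => ho_eval v ∘ ho_eval u
  end.

Lemma ho_eval_rel (x y : C) (u v : word x y) : wrel u v -> ho_eval u = ho_eval v.
Proof.
induction 1; simpl; try congruence.
- apply comp_assoc.
- rewrite fmap_id; apply comp_idl.
- rewrite fmap_id; apply comp_idr.
- apply fmap_comp.
- destruct (constructive_indefinite_description _ _) as [g [e1 e2]]; simpl.
  now rewrite fmap_id.
- destruct (constructive_indefinite_description _ _) as [g [e1 e2]]; simpl.
  now rewrite fmap_id.
Qed.

Lemma ho_eval_repr (x y : C) (u : word x y) :
  ho_eval (repr (ho_cls u)) = ho_eval u.
Proof. apply ho_eval_rel, ho_repr_cls. Qed.

Definition Ho_lift : functor Ho D.
Proof.
refine (@Functor Ho D (fun x => F x) (fun x y f => ho_eval (repr f)) _ _).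
- intro x; simpl; rewrite ho_eval_repr; apply fmap_id.
- intros x y z g f; simpl; unfold ho_comp; now rewrite ho_eval_repr.
Defined.

Lemma Ho_lift_loc (x y : C) (f : hom x y) : fmap Ho_lift (fmap loc f) = fmap F f.
Proof. exact (ho_eval_repr (w_mor f)). Qed.

End Lift.

Lemma Ho_lift_comm (D : category) (F : functor C D) (hF : inverts F) :
  (Ho_lift hF ∘ loc)%functor = F.
Proof.
assert (e : forall x y (f : hom x y), fmap (Ho_lift hF ∘ loc) f = fmap F f).
{ intros x y f; apply Ho_lift_loc. }
destruct F as [o m h1 h2]; simpl in e.
apply functor_eq; do 3 (apply functional_extensionality_dep; intro); apply e.
Qed.

Lemma inverse_uniq (D : category) (x y : D) (f : hom x y) (g g' : hom y x) :
  is_inverse f g -> is_inverse f g' -> g = g'.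
Proof.
intros [h1 h2] [h3 h4].
now rewrite <- (comp_idr g), <- h4, comp_assoc, h1, comp_idl.
Qed.

Lemma fmap_inverse (A D : category) (F : functor A D) (x y : A)
    (f : hom x y) (g : hom y x) :
  is_inverse f g -> is_inverse (fmap F f) (fmap F g).
Proof.
intros [h1 h2]; split; rewrite <- fmap_comp;
  [rewrite h1 | rewrite h2]; apply fmap_id.
Qed.

Lemma Ho_lift_unique (D : category) (K L : functor Ho D) :
  (K ∘ loc)%functor = (L ∘ loc)%functor -> K = L.
Proof.
intro e.
pose (data := fun F : functor C D =>
  existT (fun o : C -> D => forall x y : C, hom x y -> hom (o x) (o y))
    (fobj F) (@fmap _ _ F)).
apply (f_equal data) in e; unfold data in e; simpl in e; clear data.
assert (hK := @fmap_inverse _ _ K); assert (hL := @fmap_inverse _ _ L).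
destruct K as [k km k1 k2], L as [l lm l1 l2]; simpl in *.
assert (ek : k = l) by exact (f_equal (@projT1 _ _) e).
subst l; apply inj_pair2 in e.
assert (em : km = lm).
{ do 3 (apply functional_extensionality_dep; intro).
  match goal with |- _ _ _ ?f = _ => destruct (ho_clsP f) as [u ->] end.
  induction u as [x y f | x y f hf | x y z v IHv u IHu].
  - exact (f_equal (fun m => m x y f) e).
  - assert (h : is_inverse (C := Ho) (ho_cls (w_mor f)) (ho_cls (w_inv hf))).
    { split; simpl; rewrite ho_comp_cls; apply ho_cls_eq;
        [apply wr_invl | apply wr_invr]. }
    apply (inverse_uniq (hK _ _ _ _ h)).
    replace (km x y (ho_cls (w_mor f))) with (lm x y (ho_cls (w_mor f)))
      by exact (eq_sym (f_equal (fun m => m x y f) e)).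
    exact (hL _ _ _ _ h).
  - rewrite <- ho_comp_cls.
    transitivity (km y z (ho_cls v) ∘ km x y (ho_cls u)).
    { exact (k2 x y z (ho_cls v) (ho_cls u)). }
    rewrite IHv, IHu; symmetry; exact (l2 x y z (ho_cls v) (ho_cls u)). }
apply functor_eq, em.
Qed.

Theorem loc_universal (D : category) (F : functor C D) :
  inverts F -> exists! K : functor Ho D, (K ∘ loc)%functor = F.
Proof.
intro hF; exists (Ho_lift hF); split; [apply Ho_lift_comm|].
intros K hK; apply Ho_lift_unique; now rewrite hK, Ho_lift_comm.
Qed.
End Localisation.

Definition homotopical (C D : wecat) (F : functor C D) : Prop :=
  forall (x y : C) (f : hom x y), weq f -> weq (fmap F f).

Record hfunctor (C D : wecat) : Type := HFunctor {
  hfun :> functor C D;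
  hfunP : homotopical hfun
}.

Lemma loc_hfun_inverts (C D : wecat) (F : hfunctor C D) : inverts (loc D ∘ F).
Proof. intros x y f hf; apply loc_inverts, hfunP, hf. Qed.

Definition Ho_map (C D : wecat) (F : hfunctor C D) : functor (Ho C) (Ho D) :=
  Ho_lift (loc_hfun_inverts F).

Lemma Ho_map_comm (C D : wecat) (F : hfunctor C D) :
  (Ho_map F ∘ loc C)%functor = (loc D ∘ F)%functor.
Proof. apply Ho_lift_comm. Qed.

Lemma inverse_square (E : category) (a b c d : E) (f : hom a b) (g : hom c d)
    (p : hom b a) (q : hom d c) (s : hom a c) (t : hom b d) :
  p ∘ f = idc a -> f ∘ p = idc b -> q ∘ g = idc c -> g ∘ q = idc d ->
  t ∘ f = g ∘ s -> s ∘ p = q ∘ t.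
Proof.
intros p1 p2 q1 q2 e.
now rewrite <- (comp_idl (s ∘ p)), <- q1, <- comp_assoc, (comp_assoc g),
  <- e, <- (comp_assoc t), p2, comp_idr.
Qed.

Lemma square_comp (E : category) (a b c a' b' c' : E) (u : hom a b) (v : hom b c)
    (u' : hom a' b') (v' : hom b' c') (r : hom a a') (s : hom b b') (t : hom c c') :
  t ∘ v = v' ∘ s -> s ∘ u = u' ∘ r -> t ∘ (v ∘ u) = (v' ∘ u') ∘ r.
Proof. intros e1 e2; now rewrite comp_assoc, e1, <- comp_assoc, e2, comp_assoc. Qed.

(* Ho on 2-cells: since loc is the identity on objects, the component of Ho t
   at x can only be the image of t x. *)
Definition Ho_nat (C D : wecat) (F G : hfunctor C D) (t : nattrans F G) :
  nattrans (Ho_map F) (Ho_map G).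
Proof.
exists (fun x => fmap (loc D) (t x)).
intros x y f; destruct (ho_clsP f) as [u ->].
change (fmap (loc D) (t y) ∘ ho_eval (loc_hfun_inverts F) (repr (ho_cls u))
  = ho_eval (loc_hfun_inverts G) (repr (ho_cls u)) ∘ fmap (loc D) (t x)).
rewrite !ho_eval_repr.
induction u as [x y f | x y f hf | x y z v IHv u IHu].
- change (fmap (loc D) (t y) ∘ fmap (loc D) (fmap F f)
    = fmap (loc D) (fmap G f) ∘ fmap (loc D) (t x)).
  now rewrite <- !fmap_comp, nt_nat.
- cbn [ho_eval].
  destruct (constructive_indefinite_description _ _) as [p [p1 p2]].
  destruct (constructive_indefinite_description _ _) as [q [q1 q2]].
  apply (inverse_square (E := Ho D) p1 p2 q1 q2).
  change (fmap (loc D) (t y) ∘ fmap (loc D) (fmap F f)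
    = fmap (loc D) (fmap G f) ∘ fmap (loc D) (t x)).
  now rewrite <- !fmap_comp, nt_nat.
- exact (square_comp (E := Ho D) IHv IHu).
Defined.

(* The identity transformation loc D ∘ F = Ho_map F ∘ loc C. *)
Definition Ho_map_id (C D : wecat) (F : hfunctor C D) :
  nattrans (loc D ∘ F) (Ho_map F ∘ loc C).
Proof.
exists (fun x => idc (loc D (F x))).
intros x y f; rewrite comp_idl.
transitivity (fmap (loc D ∘ F) f); [reflexivity|].
rewrite <- (Ho_lift_loc (loc_hfun_inverts F) f).
symmetry; exact (comp_idr (fmap (Ho_map F) (fmap (loc C) f))).
Defined.

Definition is_left_derived (C D : wecat) (F : functor C D)
    (LF : functor (Ho C) (Ho D)) (lam : nattrans (LF ∘ loc C) (loc D ∘ F)) : Prop :=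
  is_abs_right_kan lam.

Definition is_right_derived (C D : wecat) (G : functor D C)
    (RG : functor (Ho D) (Ho C)) (rho : nattrans (loc C ∘ G) (RG ∘ loc D)) : Prop :=
  is_abs_left_kan rho.

Record is_derived_adjunction (C D : wecat) (F : functor C D) (G : functor D C)
    (A : adjunction F G)
    (LF : functor (Ho C) (Ho D)) (lam : nattrans (LF ∘ loc C) (loc D ∘ F))
    (RG : functor (Ho D) (Ho C)) (rho : nattrans (loc C ∘ G) (RG ∘ loc D))
    (dA : adjunction LF RG) : Prop := {
  da_left : is_left_derived lam;
  da_right : is_right_derived rho;
  da_unit : forall x : C,
    fmap RG (lam x) ∘ unit dA (loc C x) = rho (F x) ∘ fmap (loc C) (unit A x);
  da_counit : forall y : D,
    counit dA (loc D y) ∘ fmap LF (rho y) = fmap (loc D) (counit A y) ∘ lam (G y)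
}.

Definition derivable (C D : wecat) (F : functor C D) (G : functor D C)
    (A : adjunction F G) : Prop :=
  exists (LF : functor (Ho C) (Ho D)) (lam : nattrans (LF ∘ loc C) (loc D ∘ F))
    (RG : functor (Ho D) (Ho C)) (rho : nattrans (loc C ∘ G) (RG ∘ loc D))
    (dA : adjunction LF RG), is_derived_adjunction A lam rho dA.

Definition diag (C : wecat) (I : category) : wecat.
Proof.
refine (@WeCat (fun_cat I C) (fun X Y t => forall i : I, weq ((t : nattrans X Y) i)) _).
intros X Y t [s [h1 h2]] i; apply weq_iso.
exists ((s : nattrans Y X) i); split.
- exact (f_equal (fun r : nattrans X X => r i) h1).
- exact (f_equal (fun r : nattrans Y Y => r i) h2).
Defined.

Definition const_functor (I C : category) (x : C) : functor I C :=
  Functor (fobj := fun _ : I => x) (fmap := fun _ _ _ => idc x)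
    (fun _ => eq_refl) (fun _ _ _ _ _ => eq_sym (comp_idl (idc x))).

Section Diagrams.
Variables (C : wecat) (I : category).

Definition Delta_fun : functor C (diag C I).
Proof.
unshelve refine (@Functor C (diag C I) (fun x => const_functor I x) _ _ _).
- intros x y f; exists (fun _ => f).
  intros i j k; simpl; now rewrite comp_idl, comp_idr.
- intro x; now apply nattrans_eq.
- intros x y z g f; now apply nattrans_eq.
Defined.

Lemma Delta_homotopical : homotopical Delta_fun.
Proof. intros x y f hf i; exact hf. Qed.

Definition Delta : hfunctor C (diag C I) := HFunctor Delta_homotopical.

Definition ev_fun (i : I) : functor (diag C I) C :=
  @Functor (diag C I) C (fun X => (X : functor I C) i)
    (fun X Y t => (t : nattrans X Y) i)
    (fun X => eq_refl) (fun X Y Z t s => eq_refl).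

Lemma ev_homotopical (i : I) : homotopical (ev_fun i).
Proof. intros X Y t ht; exact (ht i). Qed.

Definition ev (i : I) : hfunctor (diag C I) C := HFunctor (ev_homotopical i).

Definition ev_mor (i j : I) (k : hom i j) : nattrans (ev i) (ev j) :=
  @NatTrans (diag C I) C (ev i) (ev j) (fun X => fmap (X : functor I C) k)
    (fun X Y t => eq_sym (nt_nat (t : nattrans X Y) k)).
End Diagrams.
Arguments Delta : clear implicits.
Arguments ev : clear implicits.
Arguments ev_mor C {I i j} k.

(* The canonical isomorphism (C^I)^J -> (C^J)^I exchanging the two variables. *)
Section Swap.
Variables (C : wecat) (I J : category).

Definition swap_row (X : functor J (diag C I)) (i : I) : functor J C :=
  (ev C I i ∘ X)%functor.

Definition swap_row_map (X : functor J (diag C I)) (i i' : I) (k : hom i i') :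
  nattrans (swap_row X i) (swap_row X i').
Proof.
exists (fun j => ev_mor C k (X j)).
intros j j' f; exact (nt_nat (ev_mor C k) (fmap X f)).
Defined.

Definition swap_obj (X : functor J (diag C I)) : functor I (diag C J).
Proof.
refine (@Functor I (diag C J) (swap_row X) (@swap_row_map X) _ _).
- intro i; apply nattrans_eq; intro j; exact (fmap_id (X j : functor I C) i).
- intros i i' i'' g f; apply nattrans_eq; intro j.
  exact (fmap_comp (X j : functor I C) g f).
Defined.

Definition swap_map (X Y : functor J (diag C I)) (t : nattrans X Y) :
  nattrans (swap_obj X) (swap_obj Y).
Proof.
unshelve eexists.
- intro i.
  exists (fun j => (t j : nattrans (X j : functor I C) (Y j : functor I C)) i).
  intros j j' f.
  exact (f_equal (fun r : nattrans (X j : functor I C) (Y j' : functor I C) => r i)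
    (nt_nat t f)).
- intros i i' k; apply nattrans_eq; intro j.
  exact (nt_nat (t j : nattrans (X j : functor I C) (Y j : functor I C)) k).
Defined.

Definition swap_fun : functor (diag (diag C I) J) (diag (diag C J) I).
Proof.
refine (@Functor (diag (diag C I) J) (diag (diag C J) I) swap_obj swap_map _ _).
- intro X; apply nattrans_eq; intro i; now apply nattrans_eq.
- intros X Y Z t s; apply nattrans_eq; intro i; now apply nattrans_eq.
Defined.

Lemma swap_homotopical : homotopical swap_fun.
Proof. intros X Y t ht i j; exact (ht j i). Qed.

Definition swap : hfunctor (diag (diag C I) J) (diag (diag C J) I) :=
  HFunctor swap_homotopical.
End Swap.
Arguments swap : clear implicits.

(* Main.v *)
Require Import Defs.
From Stdlib Require Import IndefiniteDescription.

Set Implicit Arguments.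
Unset Strict Implicit.
Unset Printing Implicit Defensive.

(** Let [E], [E'] be the derived evaluations at [j], and [L ⊣ R], [L0 ⊣ R0] the
    two hocolim adjunctions. The mates [L0 E -> E' L] of the canonical
    isomorphisms [E R -> R0 E'] are natural in [j]; the point is that they are
    invertible. By the absoluteness of the derived functors, the derived units
    of [j_! ⊣ ev_j] are invertible because the underived ones are. At an object
    [S Y] in the image of the left adjoint [S] of [E] the mate is then
    invertible, because [L S] and [S' L0] are both left adjoint to
    [E R = R0 E'] and the unit of [S' ⊣ E'] is invertible. For an arbitrary [X],
    the counit [ε : S E X -> X] is inverted by [E], hence by [L0 E], hence by
    [E' L] thanks to the given abstract isomorphism [L0 E = E' L]; naturality of
    the mate along [ε] concludes. *)

(** * Isomorphisms and pointwise invertibility of transformations *)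

Lemma iso_id (C : category) (x : C) : is_iso (idc x).
Proof. exists (idc x); split; apply comp_idl. Qed.

Lemma iso_comp (C : category) (x y z : C) (g : hom y z) (f : hom x y) :
  is_iso g -> is_iso f -> is_iso (g ∘ f).
Proof.
intros [g' [g1 g2]] [f' [f1 f2]]; exists (f' ∘ g'); split.
- now rewrite <- comp_assoc, (comp_assoc g'), g1, comp_idl.
- now rewrite <- comp_assoc, (comp_assoc f), f2, comp_idl.
Qed.

Lemma iso_fmap (C D : category) (F : functor C D) (x y : C) (f : hom x y) :
  is_iso f -> is_iso (fmap F f).
Proof. intros [g h]; exists (fmap F g); now apply fmap_inverse. Qed.

Lemma iso_cancel_r (C : category) (x y z : C) (g : hom y z) (f : hom x y) :
  is_iso f -> is_iso (g ∘ f) -> is_iso g.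
Proof.
intros [f' [f1 f2]] h.
replace g with ((g ∘ f) ∘ f') by now rewrite <- comp_assoc, f2, comp_idr.
apply iso_comp; [exact h | now exists f].
Qed.

Lemma nat_iso_pointwise (C D : category) (F G : functor C D) (t : nattrans F G) :
  nat_iso t <-> forall x, is_iso (t x).
Proof.
split.
- intros [s [h1 h2]] x; exists ((s : nattrans G F) x); split.
  + exact (f_equal (fun r : nattrans F F => r x) h1).
  + exact (f_equal (fun r : nattrans G G => r x) h2).
- intro h.
  pose (inv x := proj1_sig (constructive_indefinite_description _ (h x))).
  assert (invP : forall x, is_inverse (t x) (inv x))
    by (intro x; exact (proj2_sig (constructive_indefinite_description _ (h x)))).
  unshelve eexists.
  + exists inv; intros x y f.
    destruct (invP x) as [x1 x2], (invP y) as [y1 y2].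
    symmetry; exact (inverse_square x1 x2 y1 y2 (eq_sym (nt_nat t f))).
  + split; apply nattrans_eq; intro x; apply invP.
Qed.

(** * Adjunctions and universal arrows *)

(* The adjunction laws with the composite functors unfolded in the implicit
   objects, which is what makes them usable for rewriting after [simpl]. *)
Section AdjunctionLaws.
Variables (A B : category) (F : functor A B) (G : functor B A) (a : adjunction F G).

Lemma unit_nat (x y : A) (f : hom x y) :
  comp (y := y) (z := G (F y)) (unit a y) f
  = comp (x := x) (y := G (F x)) (fmap G (fmap F f)) (unit a x).
Proof. exact (nt_nat (unit a) f). Qed.

Lemma counit_nat (x y : B) (f : hom x y) :
  comp (y := F (G y)) (z := y) (counit a y) (fmap F (fmap G f))
  = comp (x := F (G x)) (y := x) f (counit a x).
Proof. exact (nt_nat (counit a) f). Qed.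

Lemma triangle_F (x : A) :
  comp (y := F (G (F x))) (z := F x) (counit a (F x))
    (@fmap _ _ F x (G (F x)) (unit a x)) = idc (F x).
Proof. exact (triangle_l a x). Qed.

Lemma triangle_G (y : B) :
  comp (x := G y) (y := G (F (G y)))
    (@fmap _ _ G (F (G y)) y (counit a y)) (unit a (G y)) = idc (G y).
Proof. exact (triangle_r a y). Qed.
End AdjunctionLaws.

(** The pair [(y, u)] is initial in the comma category of [x] over [G]: a left adjoint of [G] at the
    single object [x]. *)
Definition universal (A B : category) (G : functor B A) (x : A) (y : B)
    (u : hom x (G y)) : Prop :=
  forall (z : B) (g : hom x (G z)), exists! f : hom y z, fmap G f ∘ u = g.

Lemma universal_uniq (A B : category) (G : functor B A) (x : A) (y z : B)
    (u : hom x (G y)) (f g : hom y z) :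
  universal u -> fmap G f ∘ u = fmap G g ∘ u -> f = g.
Proof.
intros hu e; destruct (hu z (fmap G g ∘ u)) as [h [_ hq]].
now rewrite <- (hq f e), <- (hq g eq_refl).
Qed.

Lemma unit_universal (A B : category) (F : functor A B) (G : functor B A)
    (a : adjunction F G) (x : A) : universal (G := G) (y := F x) (unit a x).
Proof.
intros z g; simpl in *; exists (counit a z ∘ fmap F g); split.
- rewrite fmap_comp, <- comp_assoc; simpl.
  now rewrite <- unit_nat, comp_assoc, triangle_G, comp_idl.
- intros f <-.
  rewrite fmap_comp, comp_assoc; simpl.
  now rewrite counit_nat, <- comp_assoc, triangle_F, comp_idr.
Qed.

Arguments unit_universal {A B F G} a x z g.

Lemma universal_comp (A B D : category) (G : functor B A) (H : functor D B)
    (x : A) (y : B) (z : D) (u : hom x (G y)) (v : hom y (H z)) :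
  universal u -> universal v -> universal (G := (G ∘ H)%functor) (fmap G v ∘ u).
Proof.
intros hu hv t g.
destruct (hu _ g) as [f [e _]], (hv _ f) as [k [e' _]].
exists k; split.
- simpl; now rewrite comp_assoc, <- fmap_comp, e', e.
- intros k' e''; simpl in e''.
  apply (universal_uniq hv), (universal_uniq hu).
  now rewrite e', e, fmap_comp, <- comp_assoc.
Qed.

Lemma universal_iso (A B : category) (G H : functor B A) (s : nattrans G H)
    (x : A) (y : B) (u : hom x (G y)) :
  nat_iso s -> universal u -> universal (G := H) (s y ∘ u).
Proof.
intros hs hu z g; rewrite nat_iso_pointwise in hs.
destruct (hs z) as [s' [s1 s2]], (hu z (s' ∘ g)) as [f [e _]].
exists f; split.
- now rewrite comp_assoc, <- nt_nat, <- comp_assoc, e, comp_assoc, s2, comp_idl.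
- intros f' e'; apply (universal_uniq hu).
  now rewrite e, <- e', (comp_assoc (fmap H f')), <- nt_nat, !comp_assoc, s1,
    comp_idl.
Qed.

(** Two universal arrows from [x] differ by the image under [G] of an isomorphism between [y] and
    [y']. *)
Lemma universal_is_iso (A B : category) (G : functor B A) (x : A) (y y' : B)
    (u : hom x (G y)) (u' : hom x (G y')) :
  universal u -> universal u' -> is_iso u -> is_iso u'.
Proof.
intros hu hu' iu.
destruct (hu _ u') as [f [e _]], (hu' _ u) as [g [e' _]].
assert (hf : is_iso f).
{ exists g; split.
  - apply (universal_uniq hu).
    now rewrite fmap_comp, <- comp_assoc, e, e', fmap_id, comp_idl.
  - apply (universal_uniq hu').
    now rewrite fmap_comp, <- comp_assoc, e', e, fmap_id, comp_idl. }
rewrite <- e; apply iso_comp; [now apply iso_fmap | exact iu].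
Qed.

(** * Composition of adjunctions *)

Section AdjComp.
Variables (A B D : category) (F : functor A B) (G : functor B A)
  (F' : functor B D) (G' : functor D B) (a : adjunction F G) (a' : adjunction F' G').

Definition adj_comp_unit : nattrans (fid A) ((G ∘ G') ∘ (F' ∘ F)).
Proof.
exists (fun x => fmap G (unit a' (F x)) ∘ unit a x).
intros x y f; simpl.
now rewrite <- comp_assoc, unit_nat, !comp_assoc, <- !fmap_comp, unit_nat.
Defined.

Definition adj_comp_counit : nattrans ((F' ∘ F) ∘ (G ∘ G')) (fid D).
Proof.
exists (fun y => counit a' y ∘ fmap F' (counit a (G' y))).
intros x y f; simpl.
now rewrite <- comp_assoc, <- fmap_comp, counit_nat, fmap_comp, !comp_assoc,
  counit_nat.
Defined.

Definition adj_comp : adjunction (F' ∘ F)%functor (G ∘ G')%functor.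
Proof.
exists adj_comp_unit adj_comp_counit.
- intro x; simpl.
  now rewrite <- comp_assoc, <- fmap_comp, (fmap_comp F),
    (comp_assoc _ (fmap F (fmap G _))), counit_nat, <- comp_assoc, triangle_F, comp_idr, triangle_F.
- intro y; simpl.
  now rewrite comp_assoc, <- fmap_comp, (fmap_comp G'),
    <- (comp_assoc _ (fmap G' (fmap F' _))), <- unit_nat, comp_assoc, triangle_G, comp_idl, triangle_G.
Defined.
End AdjComp.

(** * Mates and their invertibility *)

Section Mate.
Variables (A B A0 B0 : category) (L : functor A B) (R : functor B A)
  (L0 : functor A0 B0) (R0 : functor B0 A0)
  (a : adjunction L R) (a0 : adjunction L0 R0).

Definition mate (E : functor A A0) (E' : functor B B0)
  (s : nattrans (E ∘ R) (R0 ∘ E')) : nattrans (L0 ∘ E) (E' ∘ L).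
Proof.
exists (fun X => counit a0 (E' (L X)) ∘ fmap L0 (s (L X) ∘ fmap E (unit a X))).
intros X Y f.
assert (n := nt_nat s (fmap L f)); simpl in *.
now rewrite <- comp_assoc, <- (fmap_comp L0), <- comp_assoc, <- (fmap_comp E),
  unit_nat, (fmap_comp E), comp_assoc, n, <- comp_assoc, (fmap_comp L0),
  !comp_assoc, counit_nat.
Defined.

(** Characterises the mate by its transpose along [a0]; with this and naturality available, [mate]
    can be opaque below. *)
Lemma mateP (E : functor A A0) (E' : functor B B0)
    (s : nattrans (E ∘ R) (R0 ∘ E')) (X : A) :
  comp (x := E X) (y := R0 (L0 (E X))) (z := R0 (E' (L X)))
    (@fmap _ _ R0 (L0 (E X)) (E' (L X)) (mate s X)) (unit a0 (E X))
  = comp (x := E X) (y := E (R (L X))) (z := R0 (E' (L X)))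
      (s (L X)) (@fmap _ _ E X (R (L X)) (unit a X)).
Proof.
unfold mate; simpl.
now rewrite fmap_comp, <- comp_assoc, <- unit_nat, comp_assoc, triangle_G, comp_idl.
Qed.

Opaque mate.

Lemma mate_natural (E1 E2 : functor A A0) (E1' E2' : functor B B0)
    (s1 : nattrans (E1 ∘ R) (R0 ∘ E1')) (s2 : nattrans (E2 ∘ R) (R0 ∘ E2'))
    (k : nattrans E1 E2) (k' : nattrans E1' E2') :
  (forall Y : B, s2 Y ∘ k (R Y) = fmap R0 (k' Y) ∘ s1 Y) ->
  forall X : A, k' (L X) ∘ mate s1 X = mate s2 X ∘ fmap L0 (k X).
Proof.
intros h X; apply (universal_uniq (unit_universal a0 (E1 X))).
assert (n := nt_nat k (unit a X)); specialize (h (L X)); simpl in *.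
now rewrite !fmap_comp, <- !comp_assoc, <- unit_nat, mateP, !comp_assoc, mateP,
  <- h, <- !comp_assoc, n.
Qed.

(** [hE] and [hE'] encode left adjoints of [E] and [E'] with invertible units, one object at a time.
    The given isomorphism [th] may be unrelated to [s]. *)
Lemma mate_iso (E : functor A A0) (E' : functor B B0)
    (s : nattrans (E ∘ R) (R0 ∘ E')) :
  nat_iso s ->
  (forall Y : A0, exists (T : A) (u : hom Y (E T)), universal u /\ is_iso u) ->
  (forall Y : B0, exists (T : B) (u : hom Y (E' T)), universal u /\ is_iso u) ->
  isomorphic (L0 ∘ E) (E' ∘ L) ->
  nat_iso (mate s).
Proof.
intros hs hE hE' [th hth]; rewrite nat_iso_pointwise in *.
assert (reflected : forall (T : A) (Y : A0) (u : hom Y (E T)),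
  universal u -> is_iso u -> is_iso (mate s T)).
{ intros T Y u hu iu.
  (* Its transpose along [a0] is the arrow in [hn], universal because it comes from composing [u]
     with the unit of [a] and applying [s]. *)
  assert (hm : universal (G := E') (mate s T ∘ fmap L0 u)).
  { assert (hn : universal (G := (R0 ∘ E')%functor)
      (s (L T) ∘ (fmap E (unit a T) ∘ u))).
    { apply (universal_iso (G := (E ∘ R)%functor)).
      - now apply nat_iso_pointwise.
      - apply (universal_comp hu (unit_universal a T)). }
    assert (e : fmap R0 (mate s T ∘ fmap L0 u) ∘ unit a0 Y
      = s (L T) ∘ (fmap E (unit a T) ∘ u)).
    { simpl; now rewrite fmap_comp, <- comp_assoc, <- unit_nat, comp_assoc, mateP,
        <- comp_assoc. }
    intros Z g.
    destruct (hn Z (fmap R0 g ∘ unit a0 Y)) as [f [e1 e2]]; simpl in e1.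
    exists f; split.
    - apply (universal_uniq (unit_universal a0 Y)).
      simpl in *; now rewrite (fmap_comp R0), <- comp_assoc, e.
    - intros f' <-; apply e2; simpl in *.
      now rewrite <- e, (fmap_comp R0 (fmap E' f')), <- comp_assoc. }
  (* By uniqueness of universal arrows, invertibility passes from [u'] to the arrow of [hm]. *)
  destruct (hE' (L0 Y)) as [T' [u' [hu' iu']]].
  apply (iso_cancel_r (iso_fmap L0 iu)).
  exact (universal_is_iso hu' hm iu'). }
intro X; destruct (hE (E X)) as [T [u [hu iu]]].
(* [ep] is the counit at [X]; by [e] its image under [E] is inverse to [u]. *)
destruct (hu X (idc (E X))) as [ep [e _]].
assert (iE : is_iso (fmap E ep)).
{ apply (iso_cancel_r iu); rewrite e; apply iso_id. }
assert (n := nt_nat (mate s) ep).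
assert (n' := nt_nat th ep); simpl in n, n'.
apply (iso_cancel_r (iso_fmap L0 iE)); simpl; rewrite n.
apply iso_comp; [|exact (reflected _ _ _ hu iu)].
(* Naturality of [th] carries invertibility from [L0 E ep] to [E' L ep]. *)
apply (iso_cancel_r (hth T)); simpl; rewrite <- n'.
apply iso_comp; [apply hth | exact (iso_fmap L0 iE)].
Qed.
End Mate.

(** * Transformations and adjunctions on localisations *)

(** The 2-dimensional universal property of [loc]: naturality extends along words, a formal inverse
    being handled by inverting the square of its weak equivalence. *)
Definition loc_nat_lift (C : wecat) (D : category) (K M : functor (Ho C) D)
  (t : nattrans (K ∘ loc C) (M ∘ loc C)) : nattrans K M.
Proof.
refine (@NatTrans _ _ K M (fun x => t x) _).
intros x y f; destruct (ho_clsP f) as [u ->].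
induction u as [x y f | x y f hf | x y z v IHv u IHu].
- exact (nt_nat t f).
- assert (h : is_inverse (C := Ho C) (ho_cls (w_mor f)) (ho_cls (w_inv hf))).
  { split; simpl; rewrite ho_comp_cls; apply ho_cls_eq;
      [apply wr_invl | apply wr_invr]. }
  destruct (fmap_inverse K h) as [p1 p2], (fmap_inverse M h) as [q1 q2].
  exact (inverse_square p1 p2 q1 q2 (nt_nat t f)).
- rewrite <- ho_comp_cls.
  change (t z ∘ fmap K (comp (c := Ho C) (ho_cls v) (ho_cls u))
    = fmap M (comp (c := Ho C) (ho_cls v) (ho_cls u)) ∘ t x).
  rewrite !fmap_comp; exact (square_comp IHv IHu).
Defined.

Lemma fmap_square (C D : category) (F : functor C D) (x y y' z : C)
    (g : hom y z) (f : hom x y) (g' : hom y' z) (f' : hom x y') :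
  g ∘ f = g' ∘ f' -> fmap F g ∘ fmap F f = fmap F g' ∘ fmap F f'.
Proof. intro e; now rewrite <- !fmap_comp, e. Qed.

Lemma Ho_map_loc (C D : wecat) (F : hfunctor C D) (x y : C) (f : hom x y) :
  fmap (Ho_map F) (fmap (loc C) f) = fmap (loc D) (fmap F f).
Proof. exact (Ho_lift_loc (loc_hfun_inverts F) f). Qed.

Lemma Ho_map_loc2 (C D E : wecat) (F : hfunctor C D) (G : hfunctor D E)
    (x y : C) (f : hom x y) :
  fmap (Ho_map G) (fmap (Ho_map F) (fmap (loc C) f)) = fmap (loc E) (fmap G (fmap F f)).
Proof. rewrite Ho_map_loc; exact (Ho_map_loc G (fmap F f)). Qed.

Definition Ho_adj (C D : wecat) (F : hfunctor C D) (G : hfunctor D C)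
  (a : adjunction F G) : adjunction (Ho_map F) (Ho_map G).
Proof.
unshelve eexists.
- apply loc_nat_lift; exists (fun x => fmap (loc C) (unit a x)).
  intros x y f.
  change (fmap (loc C) (unit a y) ∘ fmap (loc C) f =
    fmap (Ho_map G) (fmap (Ho_map F) (fmap (loc C) f)) ∘ fmap (loc C) (unit a x)).
  rewrite Ho_map_loc2; exact (fmap_square (loc C) (nt_nat (unit a) f)).
- apply loc_nat_lift; exists (fun y => fmap (loc D) (counit a y)).
  intros x y f.
  change (fmap (loc D) (counit a y) ∘ fmap (Ho_map F) (fmap (Ho_map G) (fmap (loc D) f))
    = fmap (loc D) f ∘ fmap (loc D) (counit a x)).
  rewrite Ho_map_loc2; exact (fmap_square (loc D) (nt_nat (counit a) f)).
- intro x.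
  change (fmap (loc D) (counit a (F x)) ∘ fmap (Ho_map F) (fmap (loc C) (unit a x))
    = fmap (loc D) (idc (F x))).
  rewrite Ho_map_loc, <- (triangle_l a x); symmetry; exact (fmap_comp (loc D) _ _).
- intro y.
  change (fmap (Ho_map G) (fmap (loc D) (counit a y)) ∘ fmap (loc C) (unit a (G y))
    = fmap (loc C) (idc (G y))).
  rewrite Ho_map_loc, <- (triangle_r a y); symmetry; exact (fmap_comp (loc C) _ _).
Defined.

(** * Invertibility of derived units *)

(** The inverse is the preimage under [F] of the counit at [F x]. *)
Lemma ff_unit_iso (C D : category) (F : functor C D) (G : functor D C)
    (a : adjunction F G) :
  fully_faithful F -> forall x, is_iso (unit a x).
Proof.
intros hF x; destruct (hF _ _ (counit a (F x))) as [f [e _]]; simpl in *.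
exists f; split.
- destruct (hF _ _ (fmap F (idc x))) as [i [_ hi]].
  transitivity i; [symmetry | ]; apply hi; [|reflexivity].
  rewrite fmap_comp, e, fmap_id; apply triangle_F.
- simpl; rewrite unit_nat, e; apply triangle_G.
Qed.

Section Derivable.
Variables (C D : wecat) (F : functor C D) (G : hfunctor D C).

(** Since [Ho_map G] restricts to [loc C ∘ G], [rho] itself lifts to the comparison [d]; the Kan
    property of [RG] supplies the inverse. *)
Lemma right_derived_iso (RG : functor (Ho D) (Ho C))
    (rho : nattrans (loc C ∘ G) (RG ∘ loc D)) :
  is_right_derived rho ->
  exists d : nattrans (Ho_map G) RG, nat_iso d /\ forall y : D, d y = rho y.
Proof.
intros [hk _].
unshelve epose (d := loc_nat_lift (K := Ho_map G) (M := RG) _).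
{ refine (@NatTrans _ _ (Ho_map G ∘ loc D)%functor (RG ∘ loc D)%functor
    (fun y => rho y) _); intros x y f.
  change (rho y ∘ fmap (Ho_map G) (fmap (loc D) f) = fmap RG (fmap (loc D) f) ∘ rho x).
  rewrite Ho_map_loc; exact (nt_nat rho f). }
exists d; split; [|reflexivity].
destruct (hk _ (Ho_map_id G)) as [e [he _]].
change (forall y : D, e (loc D y) ∘ rho y = idc (loc C (G y))) in he.
destruct (hk _ rho) as [i [_ hi]].
change (forall d' : nattrans RG RG,
  (forall y : D, d' (loc D y) ∘ rho y = rho y) -> i = d') in hi.
exists e; split; apply nattrans_eq; intro y.
- exact (he y).
(* Both [d ∘ e] and the identity factor [rho] through itself, hence both equal the unique such
   [i]. *)
- transitivity (i y).
  + symmetry; apply (f_equal (fun r : nattrans RG RG => r y)), hi; intro z.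
    change (rho z ∘ e (loc D z) ∘ rho z = rho z).
    rewrite <- comp_assoc, he; apply comp_idr.
  + apply (f_equal (fun r : nattrans RG RG => r y)), hi; intro z; apply comp_idl.
Qed.

Variables (a : adjunction F G) (LF : functor (Ho C) (Ho D))
  (lam : nattrans (LF ∘ loc C) (loc D ∘ F)) (RG : functor (Ho D) (Ho C))
  (rho : nattrans (loc C ∘ G) (RG ∘ loc D)) (da : adjunction LF RG).

(* [RG ∘ LF] is a right Kan extension of [RG ∘ loc D ∘ F] along [loc C] because
   [LF] is an absolute one; but that functor is isomorphic to [loc C], whose
   right Kan extension along itself is the identity. *)
Lemma derived_unit_iso :
  fully_faithful F -> is_derived_adjunction a lam rho da -> nat_iso (unit da).
Proof.
intros hF [[_ hl] hr hu _].
destruct (right_derived_iso hr) as [d [hd ed]]; rewrite nat_iso_pointwise in hd.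
(* [w] is the right-hand side of the unit condition [hu], invertible because [rho] and the underived
   unit are. *)
unshelve epose (w := _ : nattrans (loc C) (RG ∘ (loc D ∘ F))).
{ exists (fun x => rho (F x) ∘ fmap (loc C) (unit a x)); intros x y f.
  symmetry; exact (square_comp (eq_sym (nt_nat rho (fmap F f)))
    (eq_sym (fmap_square (loc C) (nt_nat (unit a) f)))). }
assert (hw : nat_iso w).
{ apply nat_iso_pointwise; intro x; apply (iso_comp (C := Ho C)).
  - exact (eq_ind _ (fun r => is_iso r) (hd (loc D (F x))) _ (ed (F x))).
  - apply (iso_fmap (loc C)); now apply ff_unit_iso. }
destruct hw as [v0 [v1 v2]].
pose (v := v0 : nattrans (RG ∘ (loc D ∘ F)) (loc C)).
assert (vw : forall x, v x ∘ w x = idc (loc C x))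
  by (intro x; exact (f_equal (fun r : nattrans (loc C) (loc C) => r x) v1)).
assert (wv : forall x, w x ∘ v x = idc (RG (loc D (F x))))
  by (intro x; exact (f_equal
    (fun r : nattrans (RG ∘ (loc D ∘ F)) (RG ∘ (loc D ∘ F)) => r x) v2)).
pose (wl := whisker_r lam RG).
(* The inverse of the derived unit is forced by [hu]: it is [RG lam] followed by the inverse [v] of
   [w]. *)
unshelve epose (e := loc_nat_lift (K := (RG ∘ LF)%functor) (M := fid (Ho C)) _).
{ refine (@NatTrans _ _ ((RG ∘ LF) ∘ loc C)%functor (fid (Ho C) ∘ loc C)%functor
    (fun x => v x ∘ wl x) _); intros x y f.
  symmetry; exact (square_comp (eq_sym (nt_nat v f)) (eq_sym (nt_nat wl f))). }
exists e; split; apply nattrans_eq; intro x.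
- change ((v x ∘ fmap RG (lam x)) ∘ unit da (loc C x) = idc (loc C x)).
  rewrite <- comp_assoc, hu; apply vw.
- destruct (hl _ RG (RG ∘ LF)%functor wl) as [i [_ hi]].
  change (forall d' : nattrans (RG ∘ LF) (RG ∘ LF),
    (forall z : C, fmap RG (lam z) ∘ d' (loc C z) = fmap RG (lam z)) -> i = d') in hi.
  (* Absoluteness enters here: endomorphisms of [RG ∘ LF] that fix [RG lam] coincide. *)
  transitivity (i x).
  + symmetry; apply (f_equal (fun r : nattrans (RG ∘ LF) (RG ∘ LF) => r x)), hi; intro z.
    change (fmap RG (lam z) ∘ (unit da (loc C z) ∘ (v z ∘ fmap RG (lam z)))
      = fmap RG (lam z)).
    rewrite comp_assoc, hu, comp_assoc.
    transitivity (idc (RG (loc D (F z))) ∘ fmap RG (lam z)); [|apply comp_idl].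
    f_equal; exact (wv z).
  + apply (f_equal (fun r : nattrans (RG ∘ LF) (RG ∘ LF) => r x)), hi; intro z.
    apply comp_idr.
Qed.
End Derivable.

(** Derivability only yields some right derived functor [RG]; its derived unit is transported along
    the isomorphism from [RG] to [Ho_map G]. *)
Lemma derivable_universal_iso (C D : wecat) (F : functor C D) (G : hfunctor D C)
    (a : adjunction F G) :
  fully_faithful F -> derivable a ->
  forall Y : Ho C, exists (T : Ho D) (u : hom Y (Ho_map G T)),
    universal u /\ is_iso u.
Proof.
intros hF [LF [lam [RG [rho [da h]]]]] Y.
assert (hu := derived_unit_iso hF h); rewrite nat_iso_pointwise in hu.
destruct (right_derived_iso (da_right h)) as [d [[d' [d1 d2]] _]].
assert (hd' : nat_iso (d' : nattrans RG (Ho_map G))) by (exists d; split; assumption).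
exists (LF Y), ((d' : nattrans RG (Ho_map G)) (LF Y) ∘ unit da Y); split.
- apply (universal_iso hd'), unit_universal.
- apply iso_comp; [now apply nat_iso_pointwise | apply hu].
Qed.

(** * Exchange of the two index variables *)

Section SwapAdjunction.
Variables (C : wecat) (I J : category).

(** The double swap of [X] has the values of [X] but is not convertible to [X], so identity
    components are repackaged as a transformation. *)
Definition swap_unit :
  nattrans (fid (diag (diag C I) J)) (swap C J I ∘ swap C I J).
Proof.
unshelve eexists.
- intro X; change (functor J (diag C I)) in X.
  apply (@NatTrans J (diag C I) X (swap_obj (swap_obj X))
    (fun j => @NatTrans I C (X j) (swap_row (swap_obj X) j)
      (fun i => idc (fobj (X j : functor I C) i))
      (fun i i' k => eq_trans (comp_idl _) (eq_sym (comp_idr _))))).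
  intros j j' k; apply nattrans_eq; intro i.
  exact (eq_trans (comp_idl _) (eq_sym (comp_idr _))).
- intros X Y t; apply nattrans_eq; intro j; apply nattrans_eq; intro i.
  exact (eq_trans (comp_idl _) (eq_sym (comp_idr _))).
Defined.

Definition swap_counit :
  nattrans (swap C J I ∘ swap C I J) (fid (diag (diag C I) J)).
Proof.
unshelve eexists.
- intro X; change (functor J (diag C I)) in X.
  apply (@NatTrans J (diag C I) (swap_obj (swap_obj X)) X
    (fun j => @NatTrans I C (swap_row (swap_obj X) j) (X j)
      (fun i => idc (fobj (X j : functor I C) i))
      (fun i i' k => eq_trans (comp_idl _) (eq_sym (comp_idr _))))).
  intros j j' k; apply nattrans_eq; intro i.
  exact (eq_trans (comp_idl _) (eq_sym (comp_idr _))).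
- intros X Y t; apply nattrans_eq; intro j; apply nattrans_eq; intro i.
  exact (eq_trans (comp_idl _) (eq_sym (comp_idr _))).
Defined.
End SwapAdjunction.

(** The exchange is presented as an adjunction so that it can be composed with the hocolim
    adjunction. *)
Definition swap_adj (C : wecat) (I J : category) :
  adjunction (swap C I J) (swap C J I).
Proof.
exists (swap_unit C I J) (swap_counit C J I).
- intro X; apply nattrans_eq; intro j; apply nattrans_eq; intro i; apply comp_idl.
- intro X; apply nattrans_eq; intro j; apply nattrans_eq; intro i; apply comp_idl.
Defined.

(** * Compatibility of evaluation with constant diagrams *)

Section EvDelta.
Variables (C : wecat) (I J : category).

Definition ev_Delta_comp (j : J) (Y : diag C J) :
  hom (c := diag C I)
    (ev (diag C I) J j (swap C J I (Delta (diag C J) I Y)))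
    (Delta C I (ev C J j Y)).
Proof.
refine (@NatTrans I C (swap_row (const_functor I Y : functor I (diag C J)) j)
  (const_functor I (fobj Y j)) (fun _ => idc (fobj Y j)) _).
reflexivity.
Defined.

Lemma ev_Delta_comp_iso (j : J) (Y : diag C J) : is_iso (ev_Delta_comp j Y).
Proof.
apply nat_iso_pointwise; intro i; apply iso_id.
Qed.

(** The canonical isomorphism between right adjoints followed by evaluations, whose mate is the
    comparison at [j]. *)
Definition ev_Delta (j : J) :
  nattrans (Ho_map (ev (diag C I) J j) ∘
             (Ho_map (swap C J I) ∘ Ho_map (Delta (diag C J) I)))
           (Ho_map (Delta C I) ∘ Ho_map (ev C J j)).
Proof.
apply loc_nat_lift; exists (fun Y => fmap (loc (diag C I)) (ev_Delta_comp j Y)).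
intros X Y f.
transitivity (fmap (loc (diag C I)) (ev_Delta_comp j Y) ∘ fmap (loc (diag C I))
  (fmap (ev (diag C I) J j) (fmap (swap C J I) (fmap (Delta (diag C J) I) f)))).
- apply (f_equal (fun h => comp (c := Ho (diag C I))
    (fmap (loc (diag C I)) (ev_Delta_comp j Y)) h)).
  refine (eq_trans (f_equal (fun h => fmap (Ho_map (ev (diag C I) J j)) h)
    (Ho_map_loc2 _ _ f)) _).
  exact (Ho_map_loc (ev (diag C I) J j) _).
- refine (eq_trans _ (f_equal (fun h => comp (c := Ho (diag C I)) h
    (fmap (loc (diag C I)) (ev_Delta_comp j X)))
    (eq_sym (Ho_map_loc2 (ev C J j) (Delta C I) f)))).
  apply (fmap_square (loc (diag C I))), nattrans_eq; intro i.
  exact (eq_trans (comp_idl _) (eq_sym (comp_idr _))).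
Defined.

Lemma ev_Delta_iso (j : J) : nat_iso (ev_Delta j).
Proof. apply nat_iso_pointwise; intro Y; exact (iso_fmap _ (ev_Delta_comp_iso j Y)). Qed.

Lemma ev_Delta_natural (j j' : J) (k : hom j j') (Y : Ho (diag C J)) :
  ev_Delta j' Y ∘ Ho_nat (ev_mor (diag C I) k)
      ((Ho_map (swap C J I) ∘ Ho_map (Delta (diag C J) I))%functor Y) =
  fmap (Ho_map (Delta C I)) (Ho_nat (ev_mor C k) Y) ∘ ev_Delta j Y.
Proof.
change (fmap (loc (diag C I)) (ev_Delta_comp j' Y) ∘ fmap (loc (diag C I))
    (ev_mor (diag C I) k (swap C J I (Delta (diag C J) I Y))) =
  fmap (Ho_map (Delta C I)) (fmap (loc C) (ev_mor C k Y)) ∘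
  fmap (loc (diag C I)) (ev_Delta_comp j Y)).
rewrite Ho_map_loc; apply (fmap_square (loc (diag C I))), nattrans_eq; intro i.
exact (eq_trans (comp_idl _) (eq_sym (comp_idr _))).
Qed.
End EvDelta.

(** * Comparison of [hocolim] with evaluation, natural in the index *)

Theorem theorem9p16 (C : wecat) (I J : category)
  (colimJ : functor (diag (diag C J) I) (diag C J))
  (adjJ : adjunction colimJ (Delta (diag C J) I))
  (hocolimJ : functor (Ho (diag (diag C J) I)) (Ho (diag C J)))
  (lamJ : nattrans (hocolimJ ∘ loc (diag (diag C J) I)) (loc (diag C J) ∘ colimJ))
  (dadjJ : adjunction hocolimJ (Ho_map (Delta (diag C J) I)))
  (derJ : is_derived_adjunction adjJ lamJ (Ho_map_id (Delta (diag C J) I)) dadjJ)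
  (colim : functor (diag C I) C)
  (adj : adjunction colim (Delta C I))
  (hocolim : functor (Ho (diag C I)) (Ho C))
  (lam : nattrans (hocolim ∘ loc (diag C I)) (loc C ∘ colim))
  (dadj : adjunction hocolim (Ho_map (Delta C I)))
  (der : is_derived_adjunction adj lam (Ho_map_id (Delta C I)) dadj)
  (evC : forall j : J,
    exists (j_sh : functor C (diag C J)) (A : adjunction j_sh (ev C J j)),
      fully_faithful j_sh /\ derivable A)
  (evCI : forall j : J,
    exists (j_sh : functor (diag C I) (diag (diag C I) J))
      (A : adjunction j_sh (ev (diag C I) J j)),
      fully_faithful j_sh /\ derivable A)
  (hocolim_ev : forall j : J,
    isomorphic (hocolim ∘ Ho_map (ev (diag C I) J j))
               (Ho_map (ev C J j) ∘ (hocolimJ ∘ Ho_map (swap C I J)))) :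
  exists beta : forall j : J,
    nattrans (hocolim ∘ Ho_map (ev (diag C I) J j))
             (Ho_map (ev C J j) ∘ (hocolimJ ∘ Ho_map (swap C I J))),
    (forall j : J, nat_iso (beta j)) /\
    (forall (j j' : J) (k : hom j j') (X : Ho (diag (diag C I) J)),
      Ho_nat (ev_mor C k) (hocolimJ (Ho_map (swap C I J) X)) ∘ beta j X
      = beta j' X ∘ fmap hocolim (Ho_nat (ev_mor (diag C I) k) X)).
Proof.
(* The left adjoint of [a] is [hocolimJ ∘ Ho_map (swap C I J)], as in the target of [beta]. *)
pose (a := adj_comp (Ho_adj (swap_adj C I J)) dadjJ).
exists (fun j => mate a dadj (ev_Delta C I j)); split.
- intro j; apply mate_iso.
  + apply ev_Delta_iso.
  + destruct (evCI j) as [S [A [hS hA]]]; exact (derivable_universal_iso hS hA).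
  + destruct (evC j) as [S [A [hS hA]]]; exact (derivable_universal_iso hS hA).
  + apply hocolim_ev.
- intros j j' k X.
  exact (mate_natural a dadj (ev_Delta_natural I k) X).
Qed.
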